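(* Let $\Lambda\in R^*$ and let $\Lambda=\sum_{i=1}^d\mathbf 1_{\zeta_i}\circ p_i(\boldsymbol\delta)$ be a generalized decomposition of $\Lambda$. For $j\in\{1,\dots,n\}$ let $V^j[\mu]$ be the generalized eigenspace of $M_{x_j}^t$ (acting on $\mathcal A_\Lambda^*$) relative to the eigenvalue $\mu$. Then for every $i\in\{1,\dots,d\}$ the multiplicity of $\mathbf 1_{\zeta_i}$ is given by $$\operatorname{mult}\mathbf 1_{\zeta_i}=\dim_{\mathbb K}\bigcap_{j=1}^nV^j[(\zeta_i)_j],$$ where $(\zeta_i)_j$ is the $j$-th coordinate of $\zeta_i$.
   Context: $\mathbb K$ is an algebraically closed field of characteristic $0$, $n\ge1$, $R=\mathbb K[x_1,\dots,x_n]$, $R^*=\mathrm{Hom}_{\mathbb K}(R,\mathbb K)$. For $\zeta\in\mathbb K^n$, $\mathbf 1_\zeta\in R^*$ is evaluation at $\zeta$. For $p\in R$, $p(\boldsymbol\delta):R\to R$ is the differential operator obtained from $p$ by replacing each variable $x_i$ with $\partial_i=\partial/\partial x_i$ (products becoming compositions). For $\alpha\in\mathbb N^n$, $\partial^\alpha p=\partial_1^{\alpha_1}\cdots\partial_n^{\alpha_n}p\in R$. For $a\in R$ and $\Lambda\in R^*$, $a\star\Lambda\in R^*$ is $b\mapsto\Lambda(ab)$; $I_\Lambda=\{a\in R:a\star\Lambda=0\}$ is an ideal and $\mathcal A_\Lambda=R/I_\Lambda$. The space $\mathcal A_\Lambda^*=\mathrm{Hom}_{\mathbb K}(\mathcal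 A_\Lambda,\mathbb K)$ is identified with $I_\Lambda^\perp=\{\Phi\in R^*:\Phi(h)=0\ \forall h\in I_\Lambda\}$. The operator $M_{x_j}^t:\mathcal A_\Lambda^*\to\mathcal A_\Lambda^*$ is $\varphi\mapsto x_j\star\varphi$. The generalized eigenspace of an operator $M$ relative to $\mu$ is $\bigcup_{m\ge1}\ker(M-\mu)^m$. Consider expressions $\Lambda=\sum_{i=1}^d\mathbf 1_{\zeta_i}\circ p_i(\boldsymbol\delta)$ with $\zeta_i\in\mathbb K^n$ distinct and $p_i\in R$; such expressions exist exactly when $I_\Lambda$ is zero-dimensional (or $\Lambda=0$). The multiplicity of $\zeta_i$ (or of $\mathbf 1_{\zeta_i}$) is $\operatorname{mult}\mathbf 1_{\zeta_i}=\dim_{\mathbb K}\langle\{\mathbf 1_{\zeta_i}\circ(\partial^\alpha p_i)(\boldsymbol\delta)\}_{\alpha\in\mathbb N^n}\rangle_{\mathbb K}$. The expression is called a generalized decomposition of $\Lambda$ if the sum of the multiplicities is minimal (in which case it equals $\dim_{\mathbb K}I_\Lambda^\perp$, the points are $\{\zeta_1,\dots,\zeta_d\}=\mathcal V(I_\Lambda)$, and all $p_i\ne0$). *)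

(* Defs.v *)
From HB Require Import structures.
From mathcomp Require Import all_boot all_order all_algebra.
From mathcomp Require Import boolp classical_sets functions.
From mathcomp Require Import mpoly.

Set Implicit Arguments.
Unset Strict Implicit.
Unset Printing Implicit Defensive.

Import GRing.Theory.
Local Open Scope ring_scope.
Local Open Scope classical_set_scope.

Section LinearAlgebra.
Variables (K : fieldType) (V : lmodType K).

Definition lin_span (F : set V) : set V :=
  [set v | exists (m : nat) (w : 'I_m -> V) (c : 'I_m -> K),
     (forall i, F (w i)) /\ v = \sum_(i < m) c i *: w i].

Definition lin_indep (m : nat) (b : 'I_m -> V) : Prop :=
  forall c : 'I_m -> K, \sum_(i < m) c i *: b i = 0 -> forall i, c i = 0.

Definition has_dim (S : set V) (m : nat) : Prop :=
  exists b : 'I_m -> V, lin_indep b /\ lin_span (range b) = S.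

(* The value is 0 when S is not a finite-dimensional subspace. *)
Definition dim (S : set V) : nat := xget 0%N (has_dim S).

(* W is meant to be stable under M; M is then regarded as an operator on W. *)
Definition gen_eigenspace (W : set V) (M : V -> V) (mu : K) : set V :=
  [set v | W v /\
     exists2 m, (0 < m)%N & iter m (fun w => M w - mu *: w) v = 0].

Lemma lin_span_rangeP (T : finType) (u : T -> V) (v : V) :
  lin_span (range u) v <-> exists c : T -> K, v = \sum_t c t *: u t.
Proof.
split=> [[m [w [c [uw ->]]]]|[c ->]].
- have /choice[t tw] : forall i, exists t, u t = w i.
    by move=> i; have [t _ <-] := uw i; exists t.
  exists (fun x => \sum_(i | t i == x) c i).
  rewrite (partition_big t predT)//=; apply: eq_bigr => x _.
  by rewrite scaler_suml; apply: eq_bigr => i /eqP <-; rewrite tw.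
- exists #|T|, (fun i => u (enum_val i)), (fun i => c (enum_val i)).
  split=> [i|]; first by exists (enum_val i).
  by rewrite (reindex (@enum_val T T))//=; apply/onW_bij/enum_val_bij.
Qed.

Lemma has_dim_inj (S : set V) (m m' : nat) :
  has_dim S m -> has_dim S m' -> m = m'.
Proof.
suff le p q : has_dim S p -> has_dim S q -> (p <= q)%N.
  by move=> h h'; apply/eqP; rewrite eqn_leq !le.
move=> [b [bI bS]] [b' [_ b'S]].
have mem (r : nat) (g : 'I_r -> V) i : lin_span (range g) (g i).
  apply/lin_span_rangeP; exists (fun j => (j == i)%:R).
  rewrite (bigD1 i)//= eqxx scale1r big1 ?addr0// => j /negbTE->.
  by rewrite scale0r.
have /choice[C CE] : forall i, exists c, b i = \sum_t c t *: b' t.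
  by move=> i; apply/lin_span_rangeP; rewrite b'S -bS; exact: mem.
have /choice[D DE] : forall i, exists c, b' i = \sum_t c t *: b t.
  by move=> i; apply/lin_span_rangeP; rewrite bS -b'S; exact: mem.
apply: (@mulmx1_min K p q (\matrix_(i, j) C i j) (\matrix_(i, j) D i j)).
apply/matrixP => i k; apply/eqP; rewrite -subr_eq0 !mxE; apply/eqP.
under eq_bigr do rewrite !mxE.
apply: (bI (fun k => \sum_j C i j * D j k - (i == k)%:R)).
under eq_bigr do rewrite scalerBl scaler_suml.
rewrite big_split/= sumrN exchange_big/= [X in _ - X](bigD1 i)//= eqxx scale1r.
rewrite [X in b i + X]big1 ?addr0; last first.
  by move=> j; rewrite eq_sym => /negbTE->; rewrite scale0r.
rewrite [X in _ - X]CE; apply/eqP; rewrite subr_eq0; apply/eqP.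
apply: eq_bigr => j _; rewrite [in RHS]DE scaler_sumr.
by apply: eq_bigr => t _; rewrite scalerA.
Qed.

Lemma has_dim_range (T : finType) (u : T -> V) :
  exists m, has_dim (lin_span (range u)) m.
Proof.
pose P m := `[< exists b : 'I_m -> V, lin_span (range b) = lin_span (range u) >].
have exP : exists m, P m.
  exists #|T|; apply/asboolP; exists (fun i => u (enum_val i)).
  congr lin_span; apply/seteqP; split=> [_ [i _ <-]|_ [t _ <-]].
    by exists (enum_val i).
  by exists (enum_rank t) => //; rewrite enum_rankK.
case: (ex_minnP exP) => m /asboolP[b bE] min_m; exists m, b; split=> // c c0 i.
apply: contrapT => /eqP ci0.
case: m => [|m] in b bE min_m c c0 i ci0 *; first by case: i ci0.
suff : P m by move/min_m; rewrite ltnn.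
apply/asboolP; exists (b \o lift i); rewrite -bE; apply/seteqP; split=> v.
  move=> [k [w [e [wb ->]]]]; exists k, w, e; split=> // j.
  by have [l _ <-] := wb j; exists (lift i l).
move/lin_span_rangeP => [e ->]; apply/lin_span_rangeP.
exists (fun j => e (lift i j) - e i * (c i)^-1 * c (lift i j)).
rewrite (bigD1_ord i)//=.
move: c0; rewrite (bigD1_ord i)//= => /eqP; rewrite addr_eq0 => /eqP cE.
have -> : b i = - ((c i)^-1 *: \sum_j c (lift i j) *: b (lift i j)).
  by rewrite -scalerN -cE scalerA mulVf// scale1r.
rewrite scalerN scalerA scaler_sumr addrC -sumrB.
by apply: eq_bigr => j _; rewrite scalerBl scalerA.
Qed.

Lemma has_dim_dim (S : set V) (m : nat) : has_dim S m -> has_dim S (dim S).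
Proof. by move=> h; rewrite /dim; case: xgetP => [x _ //|/(_ m)]. Qed.

End LinearAlgebra.

Section Duality.
Variables (K : fieldType) (n : nat).
Local Notation R := {mpoly K[n]}.

(* Linear functionals on R are elements of the function space R -> K^o, with
   its pointwise vector space structure, that are moreover linear. *)
Definition star (a : R) (L : R -> K^o) : R -> K^o := fun b => L (a * b).

Definition annihilator (L : R -> K^o) : set R := [set a | star a L = 0].

(* This is the dual of R / annihilator L. *)
Definition annihilator_perp (L : R -> K^o) : set (R -> K^o) :=
  [set Phi | linear Phi /\ forall h, annihilator L h -> Phi h = 0].

(* p(d/dx_1, ..., d/dx_n) applied to f. *)
Definition diffop (p f : R) : R := \sum_(m <- msupp p) p@_m *: f^`M[m].

Definition eval_diffop (z : 'rV[K]_n) (p : R) : R -> K^o :=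
  fun f => (diffop p f).@[z 0].

Definition mult (z : 'rV[K]_n) (p : R) : nat :=
  dim (lin_span (range (fun a : 'X_{1..n} => eval_diffop z p^`M[a]))).

Lemma eval_diffop0 (z : 'rV[K]_n) : eval_diffop z 0 = 0.
Proof.
by apply/funext => f; rewrite /eval_diffop /diffop msupp0 big_nil meval0.
Qed.

Lemma has_dim_mult (z : 'rV[K]_n) (p : R) :
  has_dim (lin_span (range (fun a : 'X_{1..n} => eval_diffop z p^`M[a])))
          (mult z p).
Proof.
pose u (a : 'X_{1..n < msize p}) := eval_diffop z p^`M[a].
suff E : lin_span (range (fun a : 'X_{1..n} => eval_diffop z p^`M[a])) =
         lin_span (range u).
  rewrite /mult E; have [m] := has_dim_range u; exact: has_dim_dim.
apply/seteqP; split=> [_ [m [w [c [wu ->]]]]|_ [m [w [c [wu ->]]]]]; last first.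
  exists m, w, c; split=> // i; have [a _ <-] := wu i; exact: imageP.
have /choice[e eE] : forall i, exists e, w i = \sum_t e t *: u t.
  move=> i; have [a _ <-] := wu i.
  case: (ltnP (mdeg a) (msize p)) => [lt_a|le_a].
    exists (fun t => (t == BMultinom lt_a)%:R).
    rewrite (bigD1 (BMultinom lt_a))//= eqxx scale1r big1 ?addr0//.
    by move=> j /negbTE->; rewrite scale0r.
  exists (fun=> 0); rewrite big1 => [|t _]; last by rewrite scale0r.
  have -> : p^`M[a] = 0; last exact: eval_diffop0.
  apply/mpolyP => b; rewrite mcoeff_mderivm mcoeff0 memN_msupp_eq0 ?mul0rn//.
  apply/negP => /msize_mdeg_lt; rewrite mdegD ltnNge.
  by rewrite (leq_trans le_a)// leq_addr.
apply/lin_span_rangeP; exists (fun t => \sum_i c i * e i t).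
under [RHS]eq_bigr do rewrite scaler_suml.
rewrite exchange_big/=; apply: eq_bigr => i _; rewrite eE scaler_sumr.
by apply: eq_bigr => t _; rewrite scalerA.
Qed.

Definition decomposition (L : R -> K^o) (d : nat)
    (z : 'I_d -> 'rV[K]_n) (p : 'I_d -> R) : Prop :=
  injective z /\ L = \sum_(i < d) eval_diffop (z i) (p i).

(* Minimality of the sum of the multiplicities is the only requirement: a point
   z i with p i = 0 has multiplicity 0 and is not excluded. *)
Definition generalized_decomposition (L : R -> K^o) (d : nat)
    (z : 'I_d -> 'rV[K]_n) (p : 'I_d -> R) : Prop :=
  decomposition L z p /\
  forall (d' : nat) (z' : 'I_d' -> 'rV[K]_n) (p' : 'I_d' -> R),
    decomposition L z' p' ->
    (\sum_(i < d) mult (z i) (p i) <= \sum_(i < d') mult (z' i) (p' i))%N.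

End Duality.

(* Main.v *)
(* Write F_k for 1_{z_k} o p_k(d) and * for the star action. By the Leibniz rule,
   (X_j - z_j) * (1_z o p(d)) = 1_z o (d_j p)(d), hence the span E_k of the
   1_{z_k} o (d^a p_k)(d) consists of elements q * F_k, which are killed by
   powers of the X_j - (z_k)_j. Functionals with this last property at distinct
   points are linearly independent, so h * Lambda = 0 forces h * F_k = 0 for all
   k, which puts every E_k inside the orthogonal of I_Lambda. Conversely, an
   element L of this orthogonal vanishes on the common kernel of the finitely
   many nonzero 1_{z_k} o (d^a p_k)(d), hence lies in the sum of the E_k; if L
   belongs to the generalized eigenspaces of z_i, independence leaves only its
   component in E_i. So E_i, of dimension mult, is the intersection of these
   eigenspaces. *)
Require Import Defs.
From mathcomp Require Import all_boot all_order all_algebra.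
From mathcomp Require Import boolp classical_sets functions.
From mathcomp Require Import mpoly ssrcomplements.

Set Implicit Arguments.
Unset Strict Implicit.

Import GRing.Theory.
Local Open Scope ring_scope.
Local Open Scope classical_set_scope.

(** * The Leibniz rule for constant-coefficient differential operators *)

Section Operators.
Variables (K : fieldType) (n : nat).
Implicit Types (p q f : {mpoly K[n]}).

(** Monomials are reached by induction on the degree, splitting off one variable that occurs; linear
    combinations give the rest. *)
Lemma mpoly_mulX_ind (P : {mpoly K[n]} -> Prop) :
  P 1 -> (forall c p q, P p -> P q -> P (c *: p + q)) ->
  (forall i p, P p -> P ('X_i * p)) -> forall p, P p.
Proof.
move=> P1 PD PX.
have P0 : P 0 by rewrite -(addNr 1) -scaleN1r; exact: PD.
have PM : forall k (m : 'X_{1..n}), mdeg m = k -> P 'X_[m].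
  elim=> [|k IH] m.
    by move/eqP; rewrite mdeg_eq0 => /eqP ->; rewrite mpolyX0.
  move=> mk; have [i mi] : exists i, m i != 0%N.
    apply/existsP; apply: contraTT isT => /existsPn/= m0.
    suff m0E : m = 0%MM by move: mk; rewrite m0E mdeg0.
    by apply/mnmP => i; have := m0 i; rewrite negbK mnm0E => /eqP.
  have le_im : (U_(i) <= m)%MM by rewrite lep1mP.
  rewrite -(submK le_im) mpolyXD mulrC; apply: PX; apply: IH.
  by apply: succn_inj; rewrite -mk -{2}(submK le_im) mdegD mdeg1 addn1.
elim/mpolyind => // c m p _ _; apply: PD; exact: PM erefl.
Qed.

(** Summing over a fixed range in place of the support lets operators with different symbols be
    added term by term. *)
Lemma diffopwE (k : nat) p f : (msize p <= k)%N ->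
  diffop p f = \sum_(m : 'X_{1..n < k}) p@_m *: f^`M[m].
Proof.
move=> le_pk; rewrite /diffop (big_mksub 'X_{1..n < k}) /=; first last.
- by move=> m /msize_mdeg_lt /leq_trans; apply.
- exact: msupp_uniq.
by rewrite big_rmcond // => m /memN_msupp_eq0 ->; rewrite scale0r.
Qed.

Lemma diffop_linearl c p q f :
  diffop (c *: p + q) f = c *: diffop p f + diffop q f.
Proof.
pose k := maxn (msize (c *: p + q)) (maxn (msize p) (msize q)).
rewrite !(@diffopwE k) ?leq_max ?leqnn ?orbT// scaler_sumr -big_split/=.
by apply: eq_bigr => m _; rewrite linearP/= scalerDl scalerA.
Qed.

Lemma diffopX (m : 'X_{1..n}) f : diffop 'X_[m] f = f^`M[m].
Proof. by rewrite /diffop msuppX big_seq1 mcoeffX eqxx scale1r. Qed.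

Lemma diffopMX (i : 'I_n) p f : diffop ('X_i * p) f = (diffop p f)^`M(i).
Proof.
elim/mpolyind: p => [|c m p _ _ IH].
  by rewrite mulr0 /diffop msupp0 big_nil mderiv0.
rewrite mulrDr -scalerAr !diffop_linearl mderivD mderivZ IH -mpolyXD !diffopX.
by rewrite addmC mderivmDm mderivmU1m.
Qed.

Lemma diffop_linear p : linear (diffop p).
Proof.
move=> c f g; rewrite /diffop scaler_sumr -big_split/=.
apply: eq_bigr => m _.
by rewrite linearP/= scalerDr !scalerA mulrC.
Qed.

Lemma mderivXU (i j : 'I_n) :
  ('X_i : {mpoly K[n]})^`M(j) = ((i == j)%:R)%:MP.
Proof.
rewrite mderivX mnm1E; case: eqP => [->|_]; last by rewrite scale0r mpolyC0.
by rewrite -{1}[U_(j)%MM]add0m addmK mpolyX0 scale1r.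
Qed.

(** Induction on the symbol: for ['X_i * p], applying the derivation in [i] to the formula for [p]
    produces a Kronecker term from ['X_j], the same one that ['X_i] yields in the derivative of
    ['X_i * p] in [j]. *)
Lemma diffop_mulX p (j : 'I_n) f :
  diffop p ('X_j * f) = 'X_j * diffop p f + diffop p^`M(j) f.
Proof.
elim/mpoly_mulX_ind: p => [|c p q IHp IHq|i p IH].
- by rewrite -mpolyX0 !diffopX !mderivm0m mpolyX0 mderivC /diffop msupp0
    big_nil addr0.
- rewrite diffop_linearl IHp IHq mderivD mderivZ !diffop_linearl mulrDr.
  by rewrite -scalerAr scalerDr addrACA.
- rewrite !diffopMX IH mderivD !mderivM !mderivXU !mul_mpolyC diffop_linearl.
  by rewrite !diffopMX [in RHS]eq_sym addrA [X in X + _]addrC.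
Qed.

End Operators.

(** * The star action, and independence of functionals supported at distinct points *)

Section Functionals.
Variables (K : fieldType) (n : nat).
Local Notation R := {mpoly K[n]}.
Implicit Types (p q f a b : R) (L : R -> K^o) (z : 'rV[K]_n).

Lemma star_star a b L : star a (star b L) = star (a * b) L.
Proof. by apply/funext => f; rewrite /star mulrCA mulrA. Qed.

Lemma star1 L : star 1 L = L.
Proof. by apply/funext => f; rewrite /star mul1r. Qed.

Lemma star0r a : star a (0 : R -> K^o) = 0.
Proof. by []. Qed.

Lemma starDr a L L' : star a (L + L') = star a L + star a L'.
Proof. by []. Qed.

Lemma starZr a (c : K) L : star a (c *: L) = c *: star a L.
Proof. by []. Qed.

Lemma star_sumr a (I : Type) (s : seq I) (F : I -> R -> K^o) :
  star a (\sum_(i <- s) F i) = \sum_(i <- s) star a (F i).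
Proof.
by elim/big_rec2: _ => [|i _ x _ <-]; rewrite ?star0r ?starDr.
Qed.

Lemma star_linear a L : linear L -> linear (star a L).
Proof. by move=> linL c f g; rewrite /star mulrDr -scalerAr linL. Qed.

Lemma linear_fun0 L : linear L -> L 0 = 0.
Proof. by move=> /(_ (-1) 0 0); rewrite scaleN1r addNr scaleN1r addNr. Qed.

Lemma starPl L : linear L -> forall (c : K) a b,
  star (c *: a + b) L = c *: star a L + star b L.
Proof.
by move=> linL c a b; apply/funext => f; rewrite /star mulrDl -scalerAl linL.
Qed.

Lemma starN1 L : linear L -> star (-1) L = - L.
Proof.
move=> linL; apply/funext => f.
by rewrite /star mulN1r -scaleN1r -[_ *: f]addr0 linL linear_fun0// addr0
  scaleN1r.
Qed.

Lemma star_XsubC L : linear L -> forall (j : 'I_n) (c : K),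
  star ('X_j - c%:MP) L = star 'X_j L - c *: L.
Proof.
move=> linL j c; rewrite -[c%:MP]mulr1 mul_mpolyC -scaleNr addrC starPl//.
by rewrite star1 scaleNr addrC.
Qed.

(** Translates the iterates in [gen_eigenspace] into the action of one polynomial, so that
    commutativity of the ring applies. *)
Lemma iter_star_XsubC L : linear L -> forall (j : 'I_n) (c : K) k,
  iter k (fun w => star 'X_j w - c *: w) L = star (('X_j - c%:MP) ^+ k) L.
Proof.
move=> linL j c; elim=> [|k IH]; first by rewrite expr0 star1.
rewrite iterS IH -star_XsubC; last exact: star_linear.
by rewrite star_star exprS.
Qed.

Lemma eval_diffop_linear z p : linear (eval_diffop z p : R -> K^o).
Proof.
by move=> c f g; rewrite /eval_diffop diffop_linear mevalD mevalZ.
Qed.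

Lemma star_eval_diffop z p (j : 'I_n) :
  star 'X_j (eval_diffop z p) =
  eval_diffop z p^`M(j) + z 0 j *: eval_diffop z p.
Proof.
apply/funext => f; rewrite /star /eval_diffop diffop_mulX mevalD mevalM mevalXU.
by rewrite addrC.
Qed.

Lemma star_XsubC_eval_diffop z p (j : 'I_n) :
  star ('X_j - (z 0 j)%:MP) (eval_diffop z p) = eval_diffop z p^`M(j).
Proof.
by rewrite star_XsubC ?star_eval_diffop ?addrK//; exact: eval_diffop_linear.
Qed.

(** These are the common generalized eigenvectors of all the coordinate operators on the whole dual,
    before any restriction to the orthogonal of an annihilator. *)
Definition supported_at z L : Prop :=
  linear L /\ forall j : 'I_n, exists k, star (('X_j - (z 0 j)%:MP) ^+ k) L = 0.

Lemma supported_star z a L : supported_at z L -> supported_at z (star a L).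
Proof.
move=> [linL suppL]; split; first exact: star_linear.
move=> j; have [k kL] := suppL j; exists k.
by rewrite star_star mulrC -star_star kL star0r.
Qed.

Lemma mderivm_mdeg_geq p (m : 'X_{1..n}) : (msize p <= mdeg m)%N -> p^`M[m] = 0.
Proof.
move=> le_pm; apply/mpolyP => b.
rewrite mcoeff_mderivm mcoeff0 memN_msupp_eq0 ?mul0rn//.
apply/negP => /msize_mdeg_lt; rewrite mdegD ltnNge.
by rewrite (leq_trans le_pm)// leq_addr.
Qed.

Lemma supported_eval_diffop z p : supported_at z (eval_diffop z p).
Proof.
split=> [|j]; first exact: eval_diffop_linear.
(* Each factor differentiates [p] once in the direction [j], and [msize p] exceeds the degree of a
   nonzero [p] by one. *)
exists (msize p).
have -> k : star (('X_j - (z 0 j)%:MP) ^+ k) (eval_diffop z p)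
    = eval_diffop z p^`M[U_(j) *+ k].
  elim: k => [|k IH]; first by rewrite expr0 star1 mulm0n mderivm0m.
  by rewrite exprS -star_star IH star_XsubC_eval_diffop -mderivmU1m -mderivmDm
    mulmSr.
by rewrite mderivm_mdeg_geq ?eval_diffop0// mdegMn mdeg1 mul1n.
Qed.

(** By induction on [k], ['X_j - c%:MP] already kills [L]; hence ['X_j] acts on [L] as [c], and the
    second power acts as the nonzero scalar [(c - e) ^+ l]. *)
Lemma star_XsubC_coprime_eq0 (j : 'I_n) (c e : K) k l L :
  linear L -> c != e ->
  star (('X_j - c%:MP) ^+ k) L = 0 -> star (('X_j - e%:MP) ^+ l) L = 0 -> L = 0.
Proof.
move=> + ce; elim: k L => [|k IH] L linL; first by rewrite expr0 star1.
rewrite exprSr -star_star => kL lL.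
have XL : star ('X_j - c%:MP) L = 0.
  apply: IH => //; first exact: star_linear.
  by rewrite star_star mulrC -star_star lL star0r.
have XeL i : star (('X_j - e%:MP) ^+ i) L = (c - e) ^+ i *: L.
  elim: i => [|i IHi]; first by rewrite !expr0 star1 scale1r.
  rewrite exprS -star_star IHi starZr star_XsubC//.
  move: XL; rewrite star_XsubC// => /eqP; rewrite subr_eq0 => /eqP ->.
  by rewrite -scalerBl scalerA exprSr.
move: lL; rewrite XeL => /(congr1 (fun w => ((c - e) ^+ l)^-1 *: w)).
by rewrite scalerA mulVf ?expf_neq0 ?subr_eq0// scale1r scaler0.
Qed.

(* A power of [X_j - z_j] kills the summand at [z], and is injective on the
   functionals supported at [z0] as soon as [z] and [z0] differ in their [j]-th
   coordinates. *)
Lemma supported_at_indep (I : Type) (s : seq I) (z : I -> 'rV[K]_n) z0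
    (F : I -> R -> K^o) L :
  supported_at z0 L -> (forall i, supported_at (z i) (F i)) ->
  all (fun i => z i != z0) s -> L = \sum_(i <- s) F i -> L = 0.
Proof.
elim: s F L => [|i s IH] F L suppL suppF; first by rewrite big_nil.
move=> /= /andP[zi zs]; rewrite big_cons => LE.
have [j zj] : exists j, z i 0 j != z0 0 j.
  by apply/existsP; apply: contraNT zi => /existsPn/= h; apply/eqP/rowP => j;
    apply/eqP; rewrite -[_ == _]negbK h.
have [k kF] := (suppF i).2 j; have [l lL] := suppL.2 j.
apply: (star_XsubC_coprime_eq0 (k := k) suppL.1 zj _ lL).
pose g := ('X_j - (z i 0 j)%:MP) ^+ k.
apply: (IH (fun i => star g (F i))) => //.
- exact: supported_star.
- by move=> i'; exact: supported_star.
- by rewrite LE starDr kF add0r star_sumr.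
Qed.

Lemma supported_at_sum0 d (z : 'I_d -> 'rV[K]_n) (F : 'I_d -> R -> K^o) :
  injective z -> (forall k, supported_at (z k) (F k)) ->
  \sum_k F k = 0 -> forall k, F k = 0.
Proof.
move=> zI suppF F0 k.
pose s := [seq i <- enum 'I_d | i != k].
(* The [k]-th summand is the sum of the opposites of the others, each written as an action of [-1]
   so that its support is preserved by [supported_star]. *)
apply: (@supported_at_indep _ s z (z k) (fun i => star (-1) (F i))).
- exact: suppF.
- by move=> i; exact: supported_star.
- by apply/allP => i; rewrite mem_filter (inj_eq zI) => /andP[].
rewrite /s big_filter big_enum_cond/=; move: F0; rewrite (bigD1 k)//=.
move=> /eqP; rewrite addr_eq0 => /eqP ->.
by rewrite -sumrN; apply: eq_bigr => i _; rewrite starN1//; exact: (suppF i).1.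
Qed.

End Functionals.

(* If the kernels of the other [l t] are not contained in that of [l ord0], a
   vector [u] witnessing it gives the coefficient [L u / l ord0 u]. *)
Lemma vanish_ker_span (K : fieldType) (U : lmodType K) (r : nat)
    (l : 'I_r -> U -> K^o) (L : U -> K^o) :
  (forall t, linear (l t)) -> linear L ->
  (forall u, (forall t, l t u = 0) -> L u = 0) ->
  exists c : 'I_r -> K, L = \sum_t c t *: l t.
Proof.
elim: r l L => [|r IH] l L linl linL kerL.
  exists (fun=> 0); rewrite big_ord0; apply/funext => u.
  by apply: kerL => -[].
have linl' t : linear (l (lift ord0 t)) by exact: linl.
have [kerl0|] := pselect (forall u,
    (forall t, l (lift ord0 t) u = 0) -> l ord0 u = 0).
  (* Here [l ord0] vanishes on the common kernel of the others and receives the coefficient 0. *)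
  have [|c LE] := IH _ L linl' linL.
    move=> u lu; apply: kerL => t; have [t' ->|->] := unliftP ord0 t.
      exact: lu.
    exact: kerl0.
  exists (fun t => if unlift ord0 t is Some t' then c t' else 0).
  rewrite big_ord_recl unlift_none scale0r add0r LE.
  by apply: eq_bigr => t _; rewrite liftK.
move/existsNP => [u /not_implyP[lu /eqP l0u]].
pose e := L u / l ord0 u.
have [v c w| v lv|c LE] := IH _ (fun v => L v - e * l ord0 v : K^o) linl'.
- rewrite linL linl mulrDr opprD addrACA; congr (_ + _).
  by rewrite scalerBr /GRing.scale/= mulrCA.
- have <- : L (- (l ord0 v / l ord0 u) *: u + v) = 0.
    apply: kerL => t; rewrite linl; have [t' ->|->] := unliftP ord0 t.
      by rewrite lu lv scaler0 addr0.
    by rewrite /GRing.scale/= mulNr divfK// addNr.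
  rewrite linL addrC scaleNr; congr (_ - _).
  by rewrite /GRing.scale/= mulrC [RHS]mulrAC mulrA.
exists (fun t => if unlift ord0 t is Some t' then c t' else e).
rewrite big_ord_recl unlift_none; apply/eqP; rewrite addrC -subr_eq; apply/eqP.
by under eq_bigr do rewrite liftK.
Qed.

(** * Inverse systems and the orthogonal of the annihilator *)

Section Decomposition.
Variables (K : fieldType) (n : nat).
Local Notation R := {mpoly K[n]}.
Implicit Types (p q a b f : R) (L : R -> K^o) (z : 'rV[K]_n).

Definition inverse_system z p : set (R -> K^o) :=
  lin_span (range (fun a : 'X_{1..n} => eval_diffop z p^`M[a])).

Lemma star_suml L (I : Type) (s : seq I) (c : I -> K) (a : I -> R) :
  linear L ->
  star (\sum_(i <- s) c i *: a i) L = \sum_(i <- s) c i *: star (a i) L.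
Proof.
move=> linL; elim/big_rec2: _ => [|i _ x _ <-]; last by rewrite starPl.
by apply/funext => f; rewrite /star mul0r linear_fun0.
Qed.

Lemma eval_diffop_mderivm_star z p (m : 'X_{1..n}) : exists q,
  eval_diffop z p^`M[m] = star q (eval_diffop z p).
Proof.
rewrite mderivm_foldr; elim: (flatten _) => [|j s [q qE]] /=.
  by exists 1; rewrite star1.
exists (('X_j - (z 0 j)%:MP) * q).
by rewrite -star_star -qE star_XsubC_eval_diffop.
Qed.

Lemma inverse_system_star z p L : inverse_system z p L ->
  exists q, L = star q (eval_diffop z p).
Proof.
move=> [k [w [c [wE ->]]]].
have /choice[q qE] : forall i, exists q, w i = star q (eval_diffop z p).
  by move=> i; have [m _ <-] := wE i; exact: eval_diffop_mderivm_star.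
exists (\sum_i c i *: q i); rewrite star_suml; last exact: eval_diffop_linear.
by apply: eq_bigr => i _; rewrite qE.
Qed.

Lemma star_eq0_mderivm z p b :
  (forall m : 'X_{1..n}, eval_diffop z p^`M[m] b = 0) ->
  star b (eval_diffop z p) = 0.
Proof.
move=> pb; apply/funext => f.
(* The claim is generalized to every derivative of [p], because moving a variable of [f] onto the
   functional differentiates the symbol once more. *)
suff h (m : 'X_{1..n}) : eval_diffop z p^`M[m] (b * f) = 0.
  by have := h 0%MM; rewrite mderivm0m.
elim/mpoly_mulX_ind: f m => [|c f g IHf IHg|j f IH] m.
- by rewrite mulr1.
- by rewrite mulrDr -scalerAr eval_diffop_linear IHf IHg scaler0 addr0.
- rewrite mulrCA -[LHS]/(star 'X_j (eval_diffop z p^`M[m]) (b * f)).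
  rewrite star_eval_diffop -mderivmU1m -mderivmDm.
  by rewrite -[LHS]/(_ + z 0 j *: _) !IH scaler0 addr0.
Qed.

Lemma inverse_system_sum z p (T : finType) (c : T -> K) (m : T -> 'X_{1..n}) :
  inverse_system z p (\sum_t c t *: eval_diffop z p^`M[m t]).
Proof.
have : lin_span (range (fun t => eval_diffop z p^`M[m t]))
    (\sum_t c t *: eval_diffop z p^`M[m t]).
  by apply/lin_span_rangeP; exists c.
move=> [k [w [e [wE ->]]]]; exists k, w, e; split=> // i.
by have [t _ <-] := wE i; exists (m t).
Qed.

Lemma supported_sub z L L' :
  supported_at z L -> supported_at z L' -> supported_at z (L - L').
Proof.
move=> [linL suppL] [linL' suppL']; split=> [c f g|j].
  by rewrite -[LHS]/(L _ - L' _) linL linL' opprD addrACA -scalerBr.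
have [k kL] := suppL j; have [k' kL'] := suppL' j; exists (k + k')%N.
rewrite -[LHS]/(star _ L - star _ L') {1}addnC !exprD -!star_star kL kL'.
by rewrite !star0r subrr.
Qed.

Section Decomposition.
Variables (d : nat) (z : 'I_d -> 'rV[K]_n) (p : 'I_d -> R).
Hypothesis zI : injective z.

Let Lambda : R -> K^o := \sum_k eval_diffop (z k) (p k).

Lemma annihilator_sum h k : annihilator Lambda h ->
  star h (eval_diffop (z k) (p k)) = 0.
Proof.
rewrite /annihilator/= star_sumr => h0.
apply: (@supported_at_sum0 _ _ d z
  (fun k => star h (eval_diffop (z k) (p k))) zI _ h0) => i.
exact/supported_star/supported_eval_diffop.
Qed.

Lemma inverse_system_perp k L :
  inverse_system (z k) (p k) L -> annihilator_perp Lambda L.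
Proof.
move=> /inverse_system_star[q ->]; split=> [|h h0].
  exact/star_linear/eval_diffop_linear.
have /(congr1 (fun w => w q)) := annihilator_sum k h0.
by rewrite /star mulrC.
Qed.

Lemma annihilator_perp_sum L : annihilator_perp Lambda L ->
  exists F : 'I_d -> R -> K^o,
    (forall k, inverse_system (z k) (p k) (F k)) /\ L = \sum_k F k.
Proof.
(* Derivatives of order at least [N] vanish for every [p k], so finitely many forms have the same
   common kernel as all of them. *)
move=> [linL L0]; pose N := \max_k msize (p k).
pose T : finType := ('I_d * 'X_{1..n < N})%type.
pose l (t : T) := eval_diffop (z t.1) (p t.1)^`M[t.2].
have linl (t : 'I_#|T|) : linear (l (enum_val t)) by exact: eval_diffop_linear.
have [f lf0|c LE] := vanish_ker_span linl linL.
  apply: L0; rewrite /annihilator/= star_sumr big1 // => k _.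
  apply: star_eq0_mderivm => m; have [le_Nm|lt_mN] := leqP N (mdeg m).
    rewrite mderivm_mdeg_geq ?eval_diffop0// (leq_trans _ le_Nm)//.
    exact: leq_bigmax.
  have := lf0 (enum_rank ((k, BMultinom lt_mN) : T)).
  by rewrite /= enum_rankK.
exists (fun k => \sum_(m : 'X_{1..n < N})
  c (enum_rank ((k, m) : T)) *: eval_diffop (z k) (p k)^`M[m]); split.
  by move=> k; exact: inverse_system_sum.
rewrite LE pair_bigA/= [RHS](reindex (@enum_val T T)) /=.
  by apply: eq_bigr => t _; rewrite -surjective_pairing enum_valK.
exact/onW_bij/enum_val_bij.
Qed.

Lemma annihilator_perp_supported k L :
  annihilator_perp Lambda L -> supported_at (z k) L ->
  inverse_system (z k) (p k) L.
Proof.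
move=> /annihilator_perp_sum[F [FE LE]] suppL.
have suppF i : supported_at (z i) (F i).
  have [q ->] := inverse_system_star (FE i).
  exact/supported_star/supported_eval_diffop.
(* Subtracting [L] from the [k]-th component makes the sum zero while keeping each support, so
   independence yields [F k = L]. *)
pose G i := F i - (if i == k then L else 0).
have suppG i : supported_at (z i) (G i).
  rewrite /G; case: eqP => [->|_]; last by rewrite subr0.
  exact: supported_sub.
have /(supported_at_sum0 zI suppG)/(_ k) : \sum_i G i = 0.
  by rewrite /G sumrB -LE -big_mkcond/= big_pred1_eq subrr.
by rewrite /G eqxx => /eqP; rewrite subr_eq0 => /eqP <-.
Qed.

End Decomposition.

End Decomposition.

Unset Implicit Arguments.
Set Strict Implicit.

Theorem corollary6p3 (K : closedFieldType) (charK0 : [pchar K] =i pred0)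
    (n : nat) (n_gt0 : (0 < n)%N)
    (Lambda : {linear {mpoly K[n]} -> K^o}) (d : nat)
    (zeta : 'I_d -> 'rV[K]_n) (p : 'I_d -> {mpoly K[n]})
    (dec : generalized_decomposition Lambda zeta p) (i : 'I_d) :
  has_dim
    (\bigcap_(j in [set: 'I_n])
       gen_eigenspace (annihilator_perp Lambda) (star 'X_j) (zeta i 0 j))
    (mult (zeta i) (p i)).
Proof.
have [[zetaI ->] _] := dec.
have := has_dim_mult (zeta i) (p i); rewrite -/(inverse_system _ _).
congr has_dim; apply/seteqP; split=> [L sysL j _|L eigL].
  split; first exact: inverse_system_perp sysL.
  have [q ->] := inverse_system_star sysL.
  have [linqL /(_ j)[k kL]] :=
    supported_star q (supported_eval_diffop (zeta i) (p i)).
  (* The successor is taken because [gen_eigenspace] asks for a positive exponent, while [k] may be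
     0. *)
  by exists k.+1; rewrite // iter_star_XsubC// exprS -star_star kL star0r.
(* Membership in the orthogonal is carried by each eigenspace, so it is read off at the first
   coordinate. *)
have [perpL _] := eigL (Ordinal n_gt0) I.
apply: annihilator_perp_supported => //; split=> [|j]; first exact: perpL.1.
have [_ [k _]] := eigL j I.
by rewrite iter_star_XsubC; [exists k|exact: perpL.1].
Qed.
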